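(* Let $k$ be a field. If a proper non-zero ideal $I$ of $kS_\infty$ admits dimension $\delta\in k$, then $\delta$ is unique and is in the image of the ring homomorphism $\mathbb{Z}\to k$.
   Context: $S_n$ is the symmetric group on $\{1,\dots,n\}$, $S_n\subset S_{n+1}$ canonically, $S_\infty=\bigcup_nS_n$, $kS_\infty=\bigcup_nkS_n$; ideals are two-sided and $I_n:=I\cap kS_n$. For $\delta\in k$, $R_\delta:kS_{n+1}\to kS_n$ is the $k$-linear map sending $\sigma\in S_n\subset S_{n+1}$ to $\delta\sigma$, and sending $\sigma\in S_{n+1}\setminus S_n$ to the permutation in $S_n$ obtained by deleting $n+1$ from the expression of $\sigma$ as a product of disjoint cycles. A proper non-zero ideal $I$ of $kS_\infty$ admits dimension $\delta\in k$ if $R_\delta(I_{n+1})\subset I_n$ for all $n>0$. *)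

(* Defs.v *)
From HB Require Import structures.
From mathcomp Require Import all_boot all_order all_algebra all_fingroup.
From mathcomp Require Import finmap.
From mathcomp Require Import monalg.

Set Implicit Arguments.
Unset Strict Implicit.
Unset Printing Implicit Defensive.

Import GRing.Theory.
Local Open Scope ring_scope.

Section LinExt.
Variables (k : nzRingType) (G : choiceType) (V : lmodType k).

Definition lin_ext (f : G -> V) (x : {malg k[G]}) : V :=
  \sum_(g <- msupp x) x@_g *: f g.

Lemma lin_extw (f : G -> V) (d : {fset G}) (x : {malg k[G]}) :
  (msupp x `<=` d)%fset -> lin_ext f x = \sum_(g <- d) x@_g *: f g.
Proof.
move=> sxd; rewrite /lin_ext (big_fset_incl _ sxd) //= => g _.
by move=> /mcoeff_outdom ->; rewrite scale0r.
Qed.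

Lemma lin_ext_is_linear f : linear (lin_ext f).
Proof.
move=> c x y.
set d := (msupp x `|` msupp y `|` msupp (c *: x + y))%fset.
have sx : (msupp x `<=` d)%fset by rewrite /d -fsetUA fsubsetUl.
have sy : (msupp y `<=` d)%fset by rewrite /d fsetUAC fsubsetUr.
have sxy : (msupp (c *: x + y) `<=` d)%fset by rewrite /d fsubsetUr.
rewrite (lin_extw _ sx) (lin_extw _ sy) (lin_extw _ sxy) scaler_sumr -big_split.
by apply: eq_bigr => g _; rewrite mcoeffD mcoeffZ scalerDl scalerA.
Qed.

HB.instance Definition _ (f : G -> V) :=
  GRing.isLinear.Build k {malg k[G]} V *:%R (lin_ext f) (lin_ext_is_linear f).

Lemma lin_extU f g : lin_ext f << g >> = f g.
Proof.
by rewrite (lin_extw _ msuppU_le) big_seq_fset1 mcoeffUU scale1r.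
Qed.

Lemma malg_basisE (x : {malg k[G]}) : x = \sum_(g <- msupp x) x@_g *: << g >>.
Proof.
rewrite {1}[x]monalgE; apply: eq_bigr => g _; apply/malgP => h.
by rewrite mcoeffZ !mcoeffU mulrnAr mulr1.
Qed.

Lemma eq_lin (f1 f2 : {linear {malg k[G]} -> V}) :
  (forall g, f1 << g >> = f2 << g >>) -> f1 =1 f2.
Proof.
move=> eqf x; rewrite [x]malg_basisE !linear_sum.
by apply: eq_bigr => g _; rewrite !linearZ eqf.
Qed.

End LinExt.

(* An alias of [{malg k[G]}]: the multiplication that the library puts on
   [{malg k[G]}] requires a [monomType], whose only invertible element is 1. *)
Definition grpalg (k : nzRingType) (G : groupType) : Type := {malg k[G]}.

HB.instance Definition _ (k : nzRingType) (G : groupType) :=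
  GRing.Lmodule.on (grpalg k G).

Section GrpAlg.
Variables (k : comNzRingType) (G : groupType).
Implicit Types (x y z : grpalg k G) (g h : G).

Definition grpalg_mul x y : grpalg k G :=
  lin_ext (fun g => lin_ext (fun h => (<< (g * h)%g >> : grpalg k G)) y) x.

Definition grpalg_one : grpalg k G := << (1%g : G) >>.

Let mul_l y : grpalg k G -> grpalg k G := grpalg_mul^~ y.
Let mul_r x : grpalg k G -> grpalg k G := grpalg_mul x.

Fact grpalg_mul_l_linear y : linear (mul_l y).
Proof. exact: lin_ext_is_linear. Qed.

Fact grpalg_mul_r_linear x : linear (mul_r x).
Proof.
move=> c y z; rewrite /mul_r.
have mulE w : grpalg_mul x w = \sum_(g <- msupp x) x@_g *:
    lin_ext (fun h => (<< (g * h)%g >> : grpalg k G)) w by [].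
rewrite !mulE scaler_sumr -big_split /=; apply: eq_bigr => g _.
by rewrite lin_ext_is_linear scalerDr !scalerA mulrC.
Qed.

HB.instance Definition _ y := GRing.isLinear.Build k _ _ _ (mul_l y)
  (grpalg_mul_l_linear y).
HB.instance Definition _ x := GRing.isLinear.Build k _ _ _ (mul_r x)
  (grpalg_mul_r_linear x).

Lemma grpalg_mulUU g h :
  grpalg_mul << g >> << h >> = << (g * h)%g >>.
Proof. by rewrite /grpalg_mul !lin_extU. Qed.

Fact grpalg_mul1 : left_id grpalg_one grpalg_mul.
Proof.
move=> x; apply: (@eq_lin _ _ (grpalg k G) (mul_r grpalg_one) idfun) => g /=.
by rewrite /mul_r grpalg_mulUU mul1g.
Qed.

Fact grpalg_mulr1 : right_id grpalg_one grpalg_mul.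
Proof.
move=> x; apply: (@eq_lin _ _ (grpalg k G) (mul_l grpalg_one) idfun) => g /=.
by rewrite /mul_l grpalg_mulUU mulg1.
Qed.

Fact grpalg_mulA : associative grpalg_mul.
Proof.
move=> x y z.
apply: (@eq_lin _ _ (grpalg k G) (mul_l (grpalg_mul y z)) (mul_l z \o mul_l y))
  => g /=; rewrite /mul_l.
apply: (@eq_lin _ _ (grpalg k G)
  (mul_r << g >> \o mul_l z) (mul_l z \o mul_r << g >>)) => h /=.
rewrite /mul_l /mul_r.
apply: (@eq_lin _ _ (grpalg k G)
  (mul_r << g >> \o mul_r << h >>) (mul_r (grpalg_mul << g >> << h >>))) => l /=.
by rewrite /mul_r !grpalg_mulUU mulgA.
Qed.

Fact grpalg_mulDl : left_distributive grpalg_mul +%R.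
Proof. by move=> x y z; exact: (linearD (mul_l z)). Qed.

Fact grpalg_mulDr : right_distributive grpalg_mul +%R.
Proof. by move=> x y z; exact: (linearD (mul_r x)). Qed.

Fact grpalg_one_neq0 : grpalg_one != 0.
Proof.
apply/eqP => /(congr1 (mcoeff (1%g : G))) /eqP.
by rewrite mcoeff0 mcoeffUU oner_eq0.
Qed.

HB.instance Definition _ := GRing.Zmodule_isNzRing.Build (grpalg k G)
  grpalg_mulA grpalg_mul1 grpalg_mulr1 grpalg_mulDl grpalg_mulDr
  grpalg_one_neq0.

Fact grpalg_scaleAl (c : k) x y : c *: (x * y) = (c *: x) * y.
Proof. by rewrite -[RHS]/(mul_l y (c *: x)) linearZ. Qed.

HB.instance Definition _ := GRing.Lmodule_isLalgebra.Build k (grpalg k G)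
  grpalg_scaleAl.

Fact grpalg_scaleAr (c : k) x y : c *: (x * y) = x * (c *: y).
Proof. by rewrite -[RHS]/(mul_r x (c *: y)) linearZ. Qed.

HB.instance Definition _ := GRing.Lalgebra_isAlgebra.Build k (grpalg k G)
  grpalg_scaleAr.

Lemma grpalgUM g h : (<< g >> : grpalg k G) * << h >> = << (g * h)%g >>.
Proof. exact: grpalg_mulUU. Qed.

End GrpAlg.

(* Points are numbered from 0, so that {1, ..., n} becomes {0, ..., n-1} and
   the point n+1 deleted by [Rdelta] is [ord_max : 'I_n.+1].  An element of [Sinf]
   is a map nat -> nat that is the identity off a finite set and injective;
   such a map is bijective.  As for ['S_n], [s * t] is "s, then t". *)
Definition Sinf : Type := {f : {fsfun nat -> nat} | fsinjectiveb f}.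

HB.instance Definition _ := Choice.on Sinf.
HB.instance Definition _ := SubType.on Sinf.

Definition Sinf_fun (s : Sinf) : nat -> nat := val s.
Coercion Sinf_fun : Sinf >-> Funclass.

Lemma SinfP (s t : Sinf) : s =1 t -> s = t.
Proof. by move=> st; apply/val_inj/fsfunP. Qed.

Lemma Sinf_inj (s : Sinf) : injective s.
Proof. exact/fsinjectiveP/(valP s). Qed.

Section SinfGroup.
Implicit Types s t : Sinf.

Fact Sinf_one_subproof : fsinjectiveb ([fsfun] : {fsfun nat -> nat}).
Proof. by apply/fsinjectiveP => i j; rewrite !fsfun0E. Qed.

Definition Sinf_one : Sinf := Sub [fsfun] Sinf_one_subproof.

Fact Sinf_mul_subproof s t : fsinjectiveb (fsfun_comp (val t) (val s)).
Proof. by apply/fsinjectiveP/fscomp_inj; exact: Sinf_inj. Qed.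

Definition Sinf_mul s t : Sinf := Sub _ (Sinf_mul_subproof s t).

Lemma Sinf_mulE s t i : Sinf_mul s t i = t (s i).
Proof. exact: fscompE. Qed.

Definition Sinf_inv_fsfun s : {fsfun nat -> nat} :=
  [fsfun j in finsupp (val s) =>
     odflt j (omap val [pick i : finsupp (val s) | s (val i) == j])].

Lemma Sinf_inv_fsfunK s : cancel (Sinf_inv_fsfun s) s.
Proof.
move=> j; rewrite /Sinf_inv_fsfun fsfunE.
have [js|/fsfun_dflt//] := boolP (j \in finsupp (val s)).
case: pickP => [i /eqP//|noi] /=; exfalso.
have /imfset_eq_fsinjectiveP /fsetP /(_ j) := valP s.
rewrite js => /imfsetP[i /= i_s ji].
by have := noi [` i_s]%fset; rewrite /= /Sinf_fun -ji eqxx.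
Qed.

Fact Sinf_inv_subproof s : fsinjectiveb (Sinf_inv_fsfun s).
Proof. exact/fsinjectiveP/(can_inj (@Sinf_inv_fsfunK s)). Qed.

Definition Sinf_inv s : Sinf := Sub _ (Sinf_inv_subproof s).

Fact Sinf_mulA : associative Sinf_mul.
Proof. by move=> s t u; apply: SinfP => i; rewrite !Sinf_mulE. Qed.

Lemma Sinf_oneE i : Sinf_one i = i.
Proof. exact: fsfun0E. Qed.

Fact Sinf_mul1 : left_id Sinf_one Sinf_mul.
Proof. by move=> s; apply: SinfP => i; rewrite Sinf_mulE Sinf_oneE. Qed.

Fact Sinf_mulg1 : right_id Sinf_one Sinf_mul.
Proof. by move=> s; apply: SinfP => i; rewrite Sinf_mulE Sinf_oneE. Qed.

Fact Sinf_mulV : left_inverse Sinf_one Sinf_inv Sinf_mul.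
Proof.
by move=> s; apply: SinfP => i; rewrite Sinf_mulE Sinf_oneE Sinf_inv_fsfunK.
Qed.

Fact Sinf_mulgV : right_inverse Sinf_one Sinf_inv Sinf_mul.
Proof.
move=> s; apply: SinfP => i; apply: (@Sinf_inj s).
by rewrite Sinf_mulE Sinf_oneE Sinf_inv_fsfunK.
Qed.

HB.instance Definition _ := isGroup.Build Sinf
  Sinf_mulA Sinf_mul1 Sinf_mulg1 Sinf_mulV Sinf_mulgV.

End SinfGroup.

Lemma SinfM (s t : Sinf) i : (s * t : Sinf)%g i = t (s i).
Proof. exact: Sinf_mulE. Qed.

Lemma Sinf1 i : (1%g : Sinf) i = i.
Proof. exact: Sinf_oneE. Qed.

Section Incl.
Variable n : nat.
Implicit Types s t : 'S_n.

Definition ext_perm s (i : nat) : nat := oapp (fun j : 'I_n => val (s j)) i (insub i).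

Lemma ext_perm_ord s (i : 'I_n) : ext_perm s i = s i.
Proof. by rewrite /ext_perm valK. Qed.

Lemma ext_perm_out s i : (n <= i)%N -> ext_perm s i = i.
Proof. by move=> ni; rewrite /ext_perm insubN // -leqNgt. Qed.

Lemma ext_perm_lt s i : (ext_perm s i < n)%N = (i < n)%N.
Proof.
case: (ltnP i n) => [i_n|ni]; last by rewrite ext_perm_out // ltnNge ni.
by rewrite (ext_perm_ord s (Ordinal i_n)) ltn_ord.
Qed.

Lemma ext_perm_inj s : injective (ext_perm s).
Proof.
move=> i j; case: (ltnP i n) => i_n eij; last first.
  by move: eij; rewrite ext_perm_out // => ei; have := ext_perm_lt s j;
    rewrite -ei !ltnNge i_n => /esym /negbFE nj; rewrite ext_perm_out in ei.
have j_n : (j < n)%N by rewrite -(ext_perm_lt s) -eij ext_perm_lt.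
move: eij; rewrite (ext_perm_ord s (Ordinal i_n)) (ext_perm_ord s (Ordinal j_n)).
by move/val_inj/perm_inj => [].
Qed.

Definition incl_fsfun s : {fsfun nat -> nat} :=
  [fsfun i in seq_fset tt (iota 0 n) => ext_perm s i].

Lemma incl_fsfunE s : incl_fsfun s =1 ext_perm s.
Proof.
move=> i; rewrite fsfunE seq_fsetE mem_iota /= add0n.
by case: ltnP => // /ext_perm_out ->.
Qed.

Fact incl_subproof s : fsinjectiveb (incl_fsfun s).
Proof.
by apply/fsinjectiveP => i j; rewrite !incl_fsfunE; exact: ext_perm_inj.
Qed.

Definition incl s : Sinf := Sub _ (incl_subproof s).

Lemma inclE s : incl s =1 ext_perm s.
Proof. exact: incl_fsfunE. Qed.

Lemma incl_inj : injective incl.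
Proof.
move=> s t st; apply/permP => i; apply: val_inj.
by have := congr1 (fun u : Sinf => u i) st; rewrite /= !inclE !ext_perm_ord.
Qed.

Lemma inclM : {morph incl : s t / (s * t)%g}.
Proof.
move=> s t; apply: SinfP => i; rewrite SinfM !inclE.
case: (ltnP i n) => [i_n|ni]; last by rewrite !ext_perm_out.
by rewrite !(ext_perm_ord _ (Ordinal i_n)) ext_perm_ord permM.
Qed.

Lemma incl1 : incl 1%g = 1%g.
Proof. by apply: (mulgI (incl 1%g)); rewrite -inclM !mulg1. Qed.

Lemma inclP (s : Sinf) :
  (forall i, (n <= i)%N -> s i = i) -> exists t : 'S_n, s = incl t.
Proof.
move=> s_fix.
have s_lt (i : 'I_n) : (s i < n)%N.
  rewrite ltnNge; apply/negP => /[dup] /s_fix /Sinf_inj si.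
  by rewrite si leqNgt ltn_ord.
pose f i := Ordinal (s_lt i).
have f_inj : injective f.
  by move=> i j /(congr1 val) /= /Sinf_inj /val_inj.
exists (perm f_inj); apply: SinfP => i; rewrite inclE.
case: (ltnP i n) => [i_n|ni]; last by rewrite ext_perm_out ?s_fix.
by rewrite (ext_perm_ord _ (Ordinal i_n)) permE.
Qed.

End Incl.

Arguments incl {n} s.

Lemma Sinf_union (s : Sinf) : exists n, exists t : 'S_n, s = incl t.
Proof.
exists (\max_(i <- finsupp (val s)) i.+1); apply: inclP => i ni.
apply: (@fsfun_dflt _ _ _ (val s)); apply/negP => i_s; move: ni.
by rewrite leqNgt => /negP; apply; exact: (@leq_bigmax_seq _ _ xpredT (fun i => i.+1) i i_s isT).
Qed.

(* [lift_perm ord_max ord_max] is the canonical inclusion of ['S_n] in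
   ['S_n.+1]. *)
Lemma incl_lift n (s : 'S_n) : incl (lift_perm ord_max ord_max s) = incl s.
Proof.
apply: SinfP => i; rewrite !inclE; case: (ltngtP i n) => [i_n|ni|->].
- pose j : 'I_n := Ordinal i_n.
  have -> : i = lift ord_max j :> nat by rewrite lift_max.
  by rewrite ext_perm_ord lift_perm_lift !lift_max ext_perm_ord.
- by rewrite !ext_perm_out // ltnW.
- by rewrite [RHS]ext_perm_out // (ext_perm_ord _ ord_max) lift_perm_id.
Qed.

Section Delete.
Variable n : nat.
Implicit Types s : 'S_n.+1.

(* In the cycle of s through [ord_max], the predecessor of [ord_max] is sent
   to the successor of [ord_max]; nothing else changes. *)
Definition del_fun s (j : 'I_n) : 'I_n :=
  let i := s (lift ord_max j) in
  odflt j (unlift ord_max (if i == ord_max then s ord_max else i)).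

Lemma lift_del_fun s j :
  let i := s (lift ord_max j) in
  lift ord_max (del_fun s j) = if i == ord_max then s ord_max else i.
Proof.
rewrite /del_fun /=; case: unliftP => [l ->//|]; case: eqP => // sj.
by rewrite -[RHS]sj => /perm_inj /eqP; rewrite (negbTE (neq_lift _ _)).
Qed.

Fact del_fun_inj s : injective (del_fun s).
Proof.
move=> i j /(congr1 (lift ord_max)); rewrite !lift_del_fun.
have neq l : (s ord_max == s (lift ord_max l)) = false.
  by rewrite (inj_eq perm_inj) (negbTE (neq_lift _ _)).
case: eqP => [si|_]; case: eqP => [sj|_].
- by move=> _; apply/(@lift_inj _ ord_max)/(@perm_inj _ s); rewrite si sj.
- by move/eqP; rewrite neq.
- by move/esym/eqP; rewrite neq.
- by move=> /perm_inj /lift_inj.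
Qed.

Definition del_max s : 'S_n := perm (@del_fun_inj s).

Lemma del_maxE s j : let i := s (lift ord_max j) in
  lift ord_max (del_max s j) = if i == ord_max then s ord_max else i.
Proof. by rewrite permE lift_del_fun. Qed.

Lemma del_max_lift (t : 'S_n) : del_max (lift_perm ord_max ord_max t) = t.
Proof.
apply/permP => j; apply: (@lift_inj _ ord_max).
by rewrite del_maxE lift_perm_lift eq_sym (negbTE (neq_lift _ _)).
Qed.

(* If (c_1 ... c_r) is a cycle of s, then the sequence obtained by deleting
   [ord_max] from it is a cycle of [del_max s]. *)
Lemma del_max_cycle s (c : seq 'I_n.+1) : uniq c -> fcycle s c ->
  fcycle (del_max s) (pmap (unlift ord_max) c).
Proof.
have unliftK : pcancel (lift ord_max) (unlift (@ord_max n)) := liftK _.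
have lift_map (q : seq 'I_n.+1) : ord_max \notin q ->
    q = map (lift ord_max) (pmap (unlift ord_max) q).
  elim: q => //= x q IHq; rewrite inE negb_or => /andP[xm /IHq {1}->].
  by case: unliftP xm => [j ->//|->]; rewrite eqxx.
have lift_path x (q : seq 'I_n) : fpath s (lift ord_max x) (map (lift ord_max) q)
    -> fpath (del_max s) x q.
  elim: q x => //= y q IHq x /andP[/eqP sx /IHq ->]; rewrite andbT.
  apply/eqP/(@lift_inj _ ord_max); rewrite del_maxE sx.
  by rewrite eq_sym (negbTE (neq_lift _ _)).
have [mc|mc] := boolP (ord_max \in c); last first.
  move=> _; rewrite {1}(lift_map c mc); case: (pmap _ c) => //= x q.
  by rewrite -map_rcons => /lift_path.
have [i p rot_c] := rot_to mc.
have -> : fcycle (del_max s) (pmap (unlift ord_max) c) =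
    fcycle (del_max s) (pmap (unlift ord_max) (rot i c)).
  by rewrite -{1}[c](cat_take_drop i) !pmap_cat -rot_size_cat rot_cycle.
rewrite -(rot_uniq i) -(rot_cycle i) rot_c /= unlift_none /=.
case/andP=> /lift_map {2}-> _.
case: (pmap _ p) => //= x q.
rewrite !rcons_path => /and3P[/eqP sm sxq /eqP sl].
rewrite lift_path //=; apply/eqP/(@lift_inj _ ord_max).
by rewrite del_maxE -last_map sl eqxx sm.
Qed.

End Delete.

Section Dimension.
Variable k : fieldType.

Definition kS (n : nat) : Type := grpalg k 'S_n.
Definition kSinf : Type := grpalg k Sinf.

HB.instance Definition _ n := GRing.Algebra.on (kS n).
HB.instance Definition _ := GRing.Algebra.on kSinf.

Definition inclA (n : nat) : kS n -> kSinf :=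
  lin_ext (fun s : 'S_n => (<< incl s >> : kSinf)).

(* [s ord_max = ord_max] says that s lies in ['S_n]; [del_max s] is then s
   itself, seen in ['S_n] (see [Rdelta_lift]). *)
Definition Rdelta (delta : k) (n : nat) : kS n.+1 -> kS n :=
  lin_ext (fun s : 'S_n.+1 =>
    if s ord_max == ord_max then delta *: (<< del_max s >> : kS n)
    else << del_max s >>).

Lemma Rdelta_lift delta n (t : 'S_n) :
  Rdelta delta (<< lift_perm ord_max ord_max t >> : kS n.+1) =
  delta *: (<< t >> : kS n).
Proof. by rewrite /Rdelta lin_extU lift_perm_id eqxx del_max_lift. Qed.

Lemma Rdelta_del delta n (s : 'S_n.+1) : s ord_max != ord_max ->
  Rdelta delta (<< s >> : kS n.+1) = << del_max s >>.
Proof. by move=> /negbTE sm; rewrite /Rdelta lin_extU sm. Qed.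

(* The intersection of I with kS_n, as a subset of kS_n ([inclA] is the
   inclusion of kS_n in kS_oo). *)
Definition restr (I : kSinf -> Prop) (n : nat) (x : kS n) : Prop := I (inclA x).

Definition admits_dimension (I : kSinf -> Prop) (delta : k) : Prop :=
  forall n : nat, (0 < n)%N ->
  forall x : kS n.+1, restr I x -> restr I (Rdelta delta x).

End Dimension.

Record two_sided_ideal (A : nzRingType) (I : A -> Prop) : Prop := {
  two_sided0 : I 0;
  two_sidedB : forall x y, I x -> I y -> I (x - y);
  two_sidedMl : forall a x, I x -> I (a * x);
  two_sidedMr : forall x a, I x -> I (x * a)
}.

(* Main.v *)
Require Import Defs.
From HB Require Import structures.
From mathcomp Require Import all_boot all_order all_algebra all_fingroup.
From mathcomp Require Import finmap monalg.
From Stdlib Require Classical_Prop.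

(** The argument compares [Rdelta] with the conditional expectation
    E : kS_{n+1} -> kS_n, the linear projection that keeps the permutations
    fixing the last point and kills the others.

    A proper non-zero ideal I is never stable under E ([not_condexp_stable]).
    Indeed E preserves the coefficient of the identity, so an E-stable I
    would contain, for every x in some I_n, the scalar obtained by projecting
    x down to kS_1 = k, which is that coefficient; after a translation, a
    non-zero x in I has a non-zero such coefficient, so 1 would be in I.

    It therefore suffices to produce E from the operators R_delta.

    Uniqueness of delta: R_delta - R_delta' = (delta - delta') E
    ([Rdelta_subl]), so an ideal with two distinct dimensions is E-stable.

    Integrality of delta: R_delta (x) = E (x (J + delta)) where J is the sum of
    the transpositions moving the last point, that is, the last Jucys-Murphy
    element ([Rdelta_condexp]).  The eigenvalues of Jucys-Murphy elements are
    contents of boxes, hence integers; so if delta is not an integer of k then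
    J + delta has a left inverse u
    ([jucys_murphy_shift_left_invertible]), and E (x) = R_delta (x u) is in I
    for every x in I_{n+1}.

    The invertibility is obtained without representation theory, by induction
    along the Jucys-Murphy elements J_m.  With s the transposition (m m+1),
    the relation J_{m+1} s = s J_m + 1 of the degenerate affine Hecke algebra
    produces an intertwiner, which transfers left invertibility of J_m + c and
    J_m + c +/- 1 to J_{m+1} + c ([left_invertible_intertwine]). *)

Set Implicit Arguments.
Unset Strict Implicit.
Unset Printing Implicit Defensive.

Import GRing.Theory.
Local Open Scope ring_scope.

(** * Transfer of invertibility by an intertwiner *)

Definition left_invertible (R : pzRingType) (x : R) : Prop :=
  exists u : R, u * x = 1.

(** The element phi = s (x - y) + 1 satisfies phi y = x phi and
    phi^2 = 1 - (x - y)^2.  If u x = 1, then phi = u x phi = u phi y lies in the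
    left ideal Ry.  Modulo Ry, phi^2 is 1 - x^2 because x and y commute, so
    (x - 1) (x + 1) is in Ry; as it is left invertible, 1 is in Ry. *)
Lemma left_invertible_intertwine (R : pzRingType) (s x y : R) :
    s * s = 1 -> x * y = y * x -> y * s = s * x + 1 ->
    left_invertible x -> left_invertible (x + 1) -> left_invertible (x - 1) ->
  left_invertible y.
Proof.
move=> ss xy ys [u ux] [v vx] [w wx].
have sy : s * y = x * s + 1.
  rewrite -[s * y]mulr1 -ss mulrA -(mulrA s y) ys mulrDr mulr1 mulrDl ss.
  by rewrite mulrA ss mul1r.
(* Abstract names rather than local definitions: rewriting must not see the
   sums inside d and phi. *)
have [d dE] : exists d, d = x - y by exists (x - y).
have [phi phiE] : exists phi, phi = s * d + 1 by exists (s * d + 1).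
have phiy : phi * y = x * phi.
  have dy : d * y = y * d by rewrite dE mulrBl mulrBr xy.
  have dyx : d + y = x by rewrite dE subrK.
  rewrite phiE mulrDl mul1r -mulrA dy mulrA sy mulrDl mul1r -addrA dyx.
  by rewrite mulrDr mulr1 mulrA.
have phiN : phi = - (d * s + 1).
  apply/eqP; rewrite -addr_eq0 phiE dE mulrBl mulrBr ys sy !opprD !addrA !subrK.
  by rewrite subrr.
have phi2 : phi * phi = 1 - d * d.
  rewrite [X in X * _]phiN mulNr mulrDl mul1r [X in _ * X]phiE mulrDr mulr1.
  rewrite -mulrA (mulrA s) ss mul1r phiN -addrA.
  by rewrite opprD opprB (addrC (d * s)) addrK addrC.
have d2 : d * d = x * x + (y - x - x) * y.
  rewrite dE !mulrBl !mulrBr xy opprB.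
  by rewrite -addrA [X in _ = _ + X]addrC.
exists (- (v * w) * (phi * u * phi + (y - x - x))).
have -> : - (v * w) * (phi * u * phi + (y - x - x)) * y =
    v * w * ((x - 1) * (x + 1)).
  rewrite -mulrA mulNr -mulrN; congr (_ * _).
  rewrite mulrDl -[_ * phi * y]mulrA phiy !mulrA -(mulrA phi u) ux mulr1 phi2.
  by rewrite d2 opprD opprB addrAC addrK -expr2 subr_sqr_1.
by rewrite mulrA -(mulrA v) wx mulr1.
Qed.

(** * Jucys-Murphy elements *)

(** Everything here holds for the images of permutations under any monoid
    morphism e from the symmetric group to an algebra. *)
Section JucysMurphy.
Variables (k : fieldType) (A : algType k) (n : nat) (e : 'S_n -> A).
Hypotheses (e1 : e 1%g = 1) (eM : {morph e : s t / (s * t)%g >-> s * t}).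
Implicit Types (s t : 'S_n) (i j l m : 'I_n).

Definition jucys_murphy m : A := \sum_(i < n | (i < m)%N) e (tperm i m).

(** Conjugation by t permutes the transpositions (i m) with i < m. *)
Lemma jucys_murphy_comm t m : t m = m -> (forall i, (t i < m)%N = (i < m)%N) ->
  e t * jucys_murphy m = jucys_murphy m * e t.
Proof.
move=> tm tlt; rewrite mulr_sumr mulr_suml.
rewrite (reindex_inj (@perm_inj _ t)) /=; apply: eq_big => // i _.
by rewrite -!eM [in RHS]conjgC tpermJ tm.
Qed.

Lemma jucys_murphyC l m : (l < m)%N ->
  jucys_murphy l * jucys_murphy m = jucys_murphy m * jucys_murphy l.
Proof.
move=> lm; rewrite mulr_suml mulr_sumr; apply: eq_bigr => i il.
have im : (i < m)%N by exact: ltn_trans il lm.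
apply: jucys_murphy_comm => [|j]; first by rewrite tpermD // -val_eqE /= ltn_eqF.
by case: tpermP => [->|->|//]; rewrite im lm.
Qed.

(** The transposition of l and m = l + 1 conjugates (i m) to (i l) for i < l;
    the remaining summand (l m) of J_m is that transposition itself, and
    contributes its square 1. *)
Lemma jucys_murphy_succ l m : m = l.+1 :> nat ->
  jucys_murphy m * e (tperm l m) = e (tperm l m) * jucys_murphy l + 1.
Proof.
move=> ml; rewrite /jucys_murphy (bigD1 l) /=; last by rewrite ml.
rewrite mulrDl addrC -eM tperm2 e1; congr (_ + 1).
rewrite mulr_sumr mulr_suml; apply: eq_big => [i|i /andP[im il]].
  by rewrite ml ltnS ltn_neqAle andbC.
by rewrite -!eM conjgC tpermJ tpermR tpermD // eq_sym // -val_eqE /= ltn_eqF.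
Qed.

(** Induction on m for all c at once: if c is not an integer of k, neither are
    c + 1 and c - 1, so the three hypotheses of [left_invertible_intertwine]
    hold for x = J_m + c. *)
Lemma jucys_murphy_shift_left_invertible (c : k) m :
  (forall z : int, c <> z%:~R) -> left_invertible (jucys_murphy m + c%:A).
Proof.
case: m => m; elim: m c => [|m IHm] c mn cNint.
  exists (c^-1%:A); rewrite /jucys_murphy big_pred0 // add0r.
  rewrite mulr_algl scalerA mulVf ?scale1r //.
  by apply/eqP; exact: (cNint 0).
have IH z : left_invertible (jucys_murphy (Ordinal (ltnW mn)) + (c + z%:~R)%:A).
  apply: IHm => t ct; apply: (cNint (t - z)).
  by rewrite rmorphB /= -ct addrK.
set m' := Ordinal mn; set l := Ordinal (ltnW mn).
apply: (@left_invertible_intertwine _ (e (tperm l m')) (jucys_murphy l + c%:A)).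
- by rewrite -eM tperm2.
- have scalC a : GRing.comm a (c%:A : A).
    by rewrite /GRing.comm mulr_algr mulr_algl.
  apply: commrD (scalC _); apply/commr_sym/commrD; last exact: scalC.
  exact/commr_sym/jucys_murphyC.
- rewrite mulrDl mulrDr jucys_murphy_succ // mulr_algr mulr_algl.
  by rewrite addrAC.
- by have := IH 0; rewrite addr0.
- by have := IH 1; rewrite scalerDl scale1r addrA.
- by have := IH (-1); rewrite scalerDl scaleN1r addrA.
Qed.

End JucysMurphy.

(** * The conditional expectation *)

Section Restriction.
Variable k : fieldType.

(** A name for the basis elements hides their expression as monomials, which
    unification would otherwise unfold. *)
Definition perm_elt n (s : 'S_n) : kS k n := << s >>.

Lemma perm_eltM n : {morph @perm_elt n : s t / (s * t)%g >-> s * t}.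
Proof. by move=> s t; rewrite /perm_elt grpalgUM. Qed.

Lemma perm_elt1 n : perm_elt 1%g = 1 :> kS k n.
Proof. by []. Qed.

Lemma eq_lin_perm n (V : lmodType k) (f g : {linear kS k n -> V}) :
  (forall s, f (perm_elt s) = g (perm_elt s)) -> f =1 g.
Proof. exact: eq_lin. Qed.

Definition condexp (n : nat) : kS k n.+1 -> kS k n :=
  lin_ext (fun s : 'S_n.+1 =>
    if s ord_max == ord_max then << del_max s >> : kS k n else 0).

HB.instance Definition _ n := GRing.Linear.on (@condexp n).
HB.instance Definition _ d n := GRing.Linear.on (@Rdelta k d n).
HB.instance Definition _ n := GRing.Linear.on (@inclA k n).

Lemma condexpU n (s : 'S_n.+1) :
  condexp (perm_elt s) =
  if s ord_max == ord_max then perm_elt (del_max s) else 0.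
Proof. exact: lin_extU. Qed.

Lemma RdeltaU d n (s : 'S_n.+1) : Rdelta d (perm_elt s) =
  if s ord_max == ord_max then d *: perm_elt (del_max s) else perm_elt (del_max s).
Proof. exact: lin_extU. Qed.

Lemma Rdelta_subl d d' n (x : kS k n.+1) :
  Rdelta d x - Rdelta d' x = (d - d') *: condexp x.
Proof.
apply: (@eq_lin_perm _ _ (@Rdelta k d n \- @Rdelta k d' n)
  ((d - d') \*: @condexp n)) => s /=.
rewrite !RdeltaU condexpU.
by case: eqP => _; [rewrite scalerBl | rewrite scaler0 subrr].
Qed.

(** On a permutation s: if s fixes the last point N, then no s (i N) with
    i < N does, and only the scalar d contributes.  Otherwise exactly one of
    them does, for i = s(N), and s (s(N) N) is s with N deleted from its
    cycle. *)
Lemma Rdelta_condexp d n (x : kS k n.+1) :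
  Rdelta d x = condexp (x * (jucys_murphy (@perm_elt n.+1) ord_max + d%:A)).
Proof.
set a := _ + d%:A.
apply: (@eq_lin_perm _ _ (@Rdelta k d n) (@condexp n \o (a \o* idfun))) => s /=.
(* The product is restated with its canonical ring structure, which the
   combinator hides behind the one of the algebra. *)
rewrite -[X in condexp X]/(perm_elt s * a) /a mulrDr mulr_algr linearD linearZ.
rewrite /= RdeltaU condexpU mulr_sumr linear_sum /=.
have [sm|sm] := eqVneq (s ord_max) ord_max.
  rewrite big1 => [|i im]; first by rewrite add0r.
  by rewrite -(perm_eltM s) condexpU permM sm tpermR -val_eqE /= ltn_eqF.
rewrite scaler0 addr0 (bigD1 (s ord_max)) /=; last first.
  by rewrite ltn_neqAle -ltnS ltn_ord andbT.
rewrite big1 => [|i /andP[im ism]]; last first.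
  rewrite -perm_eltM condexpU permM tpermD //; first by rewrite (negbTE sm).
  by rewrite eq_sym.
rewrite addr0 -perm_eltM condexpU permM tpermL eqxx.
congr perm_elt; apply/permP => j; apply: (@lift_inj _ ord_max).
rewrite !del_maxE !permM tpermL.
have neq : s ord_max != s (lift ord_max j) by rewrite (inj_eq perm_inj) neq_lift.
have [->|sj] := eqVneq (s (lift ord_max j)) ord_max.
  by rewrite tpermR (negbTE sm).
by rewrite tpermD ?(negbTE sj) // eq_sym.
Qed.

Lemma del_max_eq1 n (s : 'S_n.+1) :
  (s ord_max == ord_max) && (del_max s == 1%g) = (s == 1%g).
Proof.
apply/andP/eqP => [[/eqP sm /eqP s1]|->]; last first.
  by rewrite perm1 -(lift_perm1 ord_max) del_max_lift.
apply/permP => i; rewrite perm1.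
case: (unliftP ord_max i) => [j ->|-> //].
have := del_maxE s j; rewrite /= s1 perm1 sm.
by case: eqP => // ->.
Qed.

Lemma mcoeff_linear (G H : choiceType) (f : {linear {malg k[G]} -> {malg k[H]}})
    (g0 : G) (h0 : H) :
    (forall g, (f << g >>)@_h0 = (g == g0)%:R) ->
  forall x, (f x)@_h0 = x@_g0.
Proof.
move=> fE x; rewrite [x]malg_basisE linear_sum !raddf_sum /=.
by apply: eq_bigr => g _; rewrite linearZ /= !mcoeffZ fE mcoeffU.
Qed.

Lemma condexp_coeff1 n (x : kS k n.+1) : (condexp x)@_1%g = x@_1%g.
Proof.
apply: (mcoeff_linear (f := @condexp n)) => s /=.
rewrite condexpU -del_max_eq1; case: eqP => _; last by rewrite mcoeff0.
by rewrite mcoeffU.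
Qed.

Lemma inclAU n (s : 'S_n) : inclA (perm_elt s) = << incl s >>.
Proof. exact: lin_extU. Qed.

Lemma inclA_coeff1 n (x : kS k n) : (inclA x)@_1%g = x@_1%g.
Proof.
apply: (mcoeff_linear (f := @inclA k n)) => s /=.
rewrite -/(perm_elt s).
by rewrite inclAU mcoeffU -(@incl1 n) (inj_eq (@incl_inj n)).
Qed.

Lemma inclAM n (x y : kS k n) : inclA (x * y) = inclA x * inclA y.
Proof.
apply: (@eq_lin_perm _ _ (@inclA k n \o (y \o* idfun))
  (inclA y \o* @inclA k n)) => s /=.
apply: (@eq_lin_perm _ _ (@inclA k n \o (perm_elt s \*o idfun))
  (inclA (perm_elt s) \*o @inclA k n)) => t /=.
rewrite -[LHS]/(inclA (perm_elt s * perm_elt t)) -perm_eltM.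
rewrite [LHS]inclAU inclM -grpalgUM.
by congr (_ * _); rewrite inclAU.
Qed.

Lemma inclA_surj (x : kSinf k) :
  exists n, exists y : kS k n.+1, inclA y = x.
Proof.
suff [n ex] : exists n, forall m, (n <= m)%N -> exists y : kS k m, inclA y = x.
  by exists n; exact: ex.
rewrite [x]malg_basisE; elim/big_ind: _ => [|a b [na exa] [nb exb]|s _].
- by exists 0%N => m _; exists 0; rewrite linear0.
- exists (maxn na nb) => m; rewrite geq_max => /andP[/exa[a' <-] /exb[b' <-]].
  by exists (a' + b'); rewrite linearD.
have [n [t ->]] := Sinf_union s; exists n => m nm.
have [i mi|u ->] := @inclP m (incl t).
  by rewrite inclE ext_perm_out // (leq_trans nm).
by exists (x@_(incl u) *: perm_elt u); rewrite linearZ /= inclAU.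
Qed.

End Restriction.

(** * Ideals are not stable under the conditional expectation *)

Section Ideal.
Variables (k : fieldType) (I : kSinf k -> Prop).
Hypothesis I_ideal : two_sided_ideal I.

Lemma idealZ (c : k) x : I x -> I (c *: x).
Proof. by move=> /(two_sidedMl I_ideal c%:A); rewrite mulr_algl. Qed.

Lemma restrM n (x y : kS k n) : restr I x -> restr I (x * y).
Proof. by rewrite /restr inclAM; exact: two_sidedMr. Qed.

(** Projecting down to kS_1 = k turns an element of I into its coefficient at
    the identity, so this coefficient vanishes as I is proper; translating by
    group elements, all coefficients vanish. *)
Lemma not_condexp_stable :
  ~ (forall x, I x) -> (exists x, I x /\ x <> 0) ->
  ~ (forall n (x : kS k n.+2), restr I x -> restr I (condexp x)).
Proof.
move=> I_proper [x [Ix /eqP x0]] I_stable; apply: I_proper => z.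
have descend n (y : kS k n.+1) : restr I y -> I (y@_1%g)%:A.
  elim: n y => [|n IHn] y Iy; last first.
    by rewrite -condexp_coeff1; exact/IHn/I_stable.
  suff -> : (y@_1%g)%:A = inclA y by [].
  have -> : y = y@_1%g *: 1.
    apply/malgP => s; rewrite mcoeffZ mcoeffU.
    have -> : s = 1%g by apply/permP => i; rewrite !ord1.
    by rewrite eqxx mulr1.
  rewrite mcoeffZ mcoeffUU mulr1 linearZ /=; congr (_ *: _).
  by rewrite -[X in inclA X]/(@perm_elt k 1 1%g) inclAU incl1.
have [g gx] : exists g, x@_g != 0.
  have [x_out|[g gx]] := fset_0Vmem (msupp x); last first.
    by exists g; rewrite mcoeff_neq0.
  by case/eqP: x0; rewrite [x]malg_basisE x_out big_seq_fset0.
have [n [y yE]] := inclA_surj (x * << g^-1%g >>).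
have y1 : y@_1%g = x@_g.
  rewrite -inclA_coeff1 yE.
  pose f : {linear kSinf k -> kSinf k} :=
    (<< g^-1%g >> : kSinf k) \o* idfun.
  apply: (@mcoeff_linear k Sinf Sinf f g 1%g _ x) => h /=.
  by rewrite grpalgUM mcoeffU -(inj_eq (mulIg g)) mulgKV mul1g.
have /descend/(idealZ (x@_g)^-1) : restr I y.
  by rewrite /restr yE; exact: two_sidedMr.
rewrite y1 scalerA mulVf // scale1r => /(two_sidedMl I_ideal z).
by rewrite mulr1.
Qed.

End Ideal.

(** * The theorem *)

Theorem lemma6p2p3 (k : fieldType) (I : kSinf k -> Prop) (delta : k)
    (I_ideal : two_sided_ideal I)
    (I_proper : ~ (forall x : kSinf k, I x))
    (I_nonzero : exists x : kSinf k, I x /\ x <> 0)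
    (I_delta : admits_dimension I delta) :
  (forall delta' : k, admits_dimension I delta' -> delta' = delta) /\
  (exists m : int, delta = m%:~R).
Proof.
have I_unstable := not_condexp_stable I_ideal I_proper I_nonzero.
split=> [delta' I_delta'|].
  have [//|ne_delta] := eqVneq delta' delta.
  case: I_unstable => n x Ix.
  have -> : condexp x = (delta' - delta)^-1 *: (Rdelta delta' x - Rdelta delta x).
    by rewrite Rdelta_subl scalerA mulVf ?scale1r // subr_eq0.
  rewrite /restr linearZ linearB; apply: idealZ => //.
  by apply: two_sidedB => //; [apply: I_delta'|apply: I_delta].
apply: Classical_Prop.NNPP => delta_nint; apply: I_unstable => n x Ix.
have [|u uJ] := @jucys_murphy_shift_left_invertible k (kS k n.+2) n.+2 _
  (perm_elt1 k n.+2) (@perm_eltM k n.+2) delta ord_max.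
  by move=> z dz; apply: delta_nint; exists z.
rewrite -[x]mulr1 -uJ mulrA -Rdelta_condexp.
exact: (@I_delta n.+1 isT _ (restrM I_ideal u Ix)).
Qed.
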